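(* Let $X$ be a reversible Markov chain with finite state space $S$ and stationary distribution $\pi$. Then, for any $x\in S$, $$\sum_{y\in S}p^*(x,y)\le 2e\cdot\max\left(1,\log\frac{1}{\pi(x)}\right).$$
   Context: Markov chains are in discrete time and time-homogeneous, with one-step transition probabilities $p(\cdot,\cdot)$; $p^t(x,y)$ is the transition probability from $x$ to $y$ in $t$ steps. Define $p^*(x,y)=\sup_{t\ge0}p^t(x,y)$, the supremum being over integers $t\ge 0$. Reversible with stationary distribution $\pi$ means $\pi(a)p(a,b)=\pi(b)p(b,a)$ for all $a,b\in S$; if $\pi(x)=0$ the right-hand side is read as $+\infty$. $\log$ is the natural logarithm. *)

(* Defs.v *)
From mathcomp Require Export all_boot all_order all_algebra.
From mathcomp Require Export all_classical all_reals all_analysis.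

Set Implicit Arguments.
Unset Strict Implicit.
Unset Printing Implicit Defensive.

Import Order.TTheory GRing.Theory Num.Theory.
Local Open Scope classical_set_scope.
Local Open Scope ring_scope.

(* A time-homogeneous Markov chain with finite state space S is given by its
   one-step transition probabilities. *)
Definition transition_matrix (R : realType) (S : finType) (p : S -> S -> R) :
    Prop :=
  (forall x y, 0 <= p x y) /\ (forall x, \sum_(y : S) p x y = 1).

Definition distribution_on (R : realType) (S : finType) (pi : S -> R) : Prop :=
  (forall x, 0 <= pi x) /\ \sum_(x : S) pi x = 1.

Definition reversible (R : realType) (S : finType) (p : S -> S -> R)
    (pi : S -> R) : Prop :=
  forall a b, pi a * p a b = pi b * p b a.

Fixpoint step_prob (R : realType) (S : finType) (p : S -> S -> R) (t : nat)
    (x y : S) : R :=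
  if t is t'.+1 then \sum_(z : S) p x z * step_prob p t' z y
  else (x == y)%:R.

(* [sup] is junk on unbounded sets; for a transition matrix all the step
   probabilities lie in [0, 1], so this is the true supremum. *)
Definition pstar (R : realType) (S : finType) (p : S -> S -> R) (x y : S) : R :=
  sup (range (fun t : nat => step_prob p t x y)).

(* Main.v *)
Require Import Defs.
From mathcomp Require Import lra.

Set Implicit Arguments.
Unset Strict Implicit.
Unset Printing Implicit Defensive.

Import Order.TTheory GRing.Theory Num.Theory.
Local Open Scope ring_scope.

(** Reversibility gives [pi x * p^t(x,y) = pi y * p^t(y,x)], so the sum of
    maximal probabilities is a maximal function bound for [P^t 1_x] in
    [L^1(pi)].  As in Rota's argument, [P^(2n) f (y)] is the conditional
    expectation given [X_0 = y] of [M_n = (P^n f)(X_n)], and [M_n] is a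
    martingale for the chain run backwards from a large time down to [0].  For a
    martingale in [[0, 1]] with running maximum [s] and current value [m], the
    function [s - m * ln s] decreases in mean, because
    [u - u * ln u <= s - u * ln s]; hence the expected maximum is at most
    [a - m * ln a] for every [0 < a <= 1], where [m] is the mean.  Taking
    [a = m = pi x] bounds the even times by [1 - ln (pi x)]; the odd times are
    the same with [f = P 1_x], and [2 <= e]. *)

(** Lets a separate time [t i] be fixed for each index, up to an arbitrarily small loss shared
    equally. The [+ 1] keeps the share meaningful for empty [I]. *)
Lemma ler_sup_approx (R : realType) (I : finType) (u : I -> nat -> R) (c : R) :
    (forall i, has_ubound (range (u i))) ->
    (forall t : I -> nat, \sum_i u i (t i) <= c) ->
  \sum_i sup (range (u i)) <= c.
Proof.
move=> hu hc; apply/ler_addgt0Pr => e e0.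
have d0 : 0 < e / (#|I|%:R + 1) by rewrite divr_gt0 // ltr_wpDl.
have /choice [t ht] : forall i, exists n,
    sup (range (u i)) <= u i n + e / (#|I|%:R + 1).
  move=> i; have hs : has_sup (range (u i)) by split => //; exists (u i 0%N), 0%N.
  have [_ [n _ <-] hn] := sup_adherent d0 hs.
  by exists n; rewrite -lerBlDr ltW.
apply: (le_trans (ler_sum _ (fun i _ => ht i))).
rewrite big_split /= lerD // sumr_const -[leLHS]mulr_natr -mulrA ler_piMr ?(ltW e0) //.
by rewrite mulrC ler_pdivrMr ?ltr_wpDl // mul1r lerDl.
Qed.

(** The tangent bound [ln r <= r - 1] at [r = s / u], scaled by [u]. *)
Lemma subr_mul_ln_le (R : realType) (s u : R) : 0 < s -> 0 <= u ->
  u - u * ln u <= s - u * ln s.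
Proof.
move=> s0; rewrite le_eqVlt => /orP[/eqP <-|u0].
  by rewrite !mul0r !subr0 ltW.
have : ln (s / u) <= s / u - 1.
  by rewrite -[s / u in leLHS](subrKC 1) le_ln1Dx // ltrBrDl subrr divr_gt0.
rewrite ln_div ?posrE // -(ler_pM2l u0) !mulrBr mulr1 mulrCA mulfV ?gt_eqF //.
by rewrite mulr1 => h; lra.
Qed.

Section Chain.
Context (R : realType) (S : finType) (p : S -> S -> R).
Hypothesis hp : transition_matrix p.

Lemma step_prob_ge0 t x y : 0 <= step_prob p t x y.
Proof.
elim: t x => [|t IH] x /=; first exact: ler0n.
by apply: sumr_ge0 => z _; rewrite mulr_ge0 ?hp.1.
Qed.

Lemma step_prob_sum1 t x : \sum_y step_prob p t x y = 1.
Proof.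
elim: t x => [|t IH] x /=.
  by rewrite (bigD1 x) //= eqxx big1 ?addr0 // => y /negPf; rewrite eq_sym => ->.
rewrite exchange_big /= -[RHS](hp.2 x); apply: eq_bigr => z _.
by rewrite -mulr_sumr IH mulr1.
Qed.

Lemma step_prob_le1 t x y : step_prob p t x y <= 1.
Proof.
rewrite -(step_prob_sum1 t x) (bigD1 y) //= lerDl.
by apply: sumr_ge0 => z _; exact: step_prob_ge0.
Qed.

Lemma sum_step_prob0 (f : S -> R) x : \sum_z step_prob p 0 x z * f z = f x.
Proof.
rewrite (bigD1 x) //= eqxx mul1r big1 ?addr0 // => y /negPf.
by rewrite eq_sym => ->; rewrite mul0r.
Qed.

Lemma sum_step_probS t (f : S -> R) x :
  \sum_y step_prob p t.+1 x y * f y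
  = \sum_z p x z * \sum_y step_prob p t z y * f y.
Proof.
under eq_bigr do rewrite /= mulr_suml.
rewrite exchange_big /=; apply: eq_bigr => z _.
by rewrite mulr_sumr; apply: eq_bigr => y _; rewrite mulrA.
Qed.

Lemma step_probD s t x y :
  step_prob p (s + t)%N x y = \sum_z step_prob p s x z * step_prob p t z y.
Proof.
elim: s x => [|s IH] x; first by rewrite sum_step_prob0.
rewrite sum_step_probS /=; apply: eq_bigr => z _.
by rewrite IH.
Qed.

Lemma step_prob_reversible pi t x y : reversible p pi ->
  pi x * step_prob p t x y = pi y * step_prob p t y x.
Proof.
move=> hrev; elim: t x y => [|t IH] x y.
  by rewrite /= eq_sym; case: eqVneq => [->|_] //; rewrite !mulr0.
rewrite -[in RHS]addn1 step_probD /= !mulr_sumr; apply: eq_bigr => z _.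
rewrite mulrA hrev mulrAC IH -!mulrA; congr (_ * (_ * _)).
under eq_bigr do rewrite mulrC.
by rewrite (bigD1 x) //= eqxx mul1r big1 ?addr0 // => w /negPf ->; rewrite mul0r.
Qed.

Lemma step_prob_stationary pi t y : reversible p pi ->
  \sum_x pi x * step_prob p t x y = pi y.
Proof.
move=> hrev; under eq_bigr do rewrite step_prob_reversible //.
by rewrite -mulr_sumr step_prob_sum1 mulr1.
Qed.

Lemma sum_step_prob_itv t (f : S -> R) x : (forall y, 0 <= f y <= 1) ->
  0 <= \sum_y step_prob p t x y * f y <= 1.
Proof.
move=> hf; apply/andP; split.
  apply: sumr_ge0 => y _; rewrite mulr_ge0 ?step_prob_ge0 //.
  by case/andP: (hf y).
rewrite -(step_prob_sum1 t x); apply: ler_sum => y _.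
by rewrite ler_piMr ?step_prob_ge0 //; case/andP: (hf y).
Qed.

Section Maximal.
Context (f : S -> R) (n : S -> nat).
Hypothesis hf : forall y, 0 <= f y <= 1.

Let g t z := \sum_y step_prob p t z y * f y.

(* For the chain run from [z] with [k] steps left, the expectation of
   [(P^(n y) f)(X)] on the event of ending at [y], where [X] is the position
   with [n y] steps left; if that moment has passed, [s] replaces the value. *)
Let split_mass k z y (s : R) :=
  if (n y <= k)%N then
    \sum_w step_prob p (k - n y)%N z w * (g (n y) w * step_prob p (n y) w y)
  else s * step_prob p k z y.

(** The moment with [n y] steps left is ahead, past or now. In the last two cases the updated
    maximum dominates the value in use. *)
Let split_massS k z y (s : R) :
  split_mass k.+1 z y s
  <= \sum_z' p z z' * split_mass k z' y (Num.max s (g k.+1 z)).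
Proof.
rewrite /split_mass; case: (ltngtP (n y) k.+1) => [|hk|hk].
- rewrite ltnS => hk; rewrite hk subSn // sum_step_probS lexx //.
- rewrite leqNgt (ltn_trans _ hk) //= .
  under [leRHS]eq_bigr do rewrite mulrCA.
  by rewrite -mulr_sumr ler_wpM2r ?(step_prob_ge0 k.+1) // le_max lexx.
- rewrite hk ltnn subnn sum_step_prob0.
  under [leRHS]eq_bigr do rewrite mulrCA.
  by rewrite -mulr_sumr ler_wpM2r ?(step_prob_ge0 k.+1) // le_max lexx orbT.
Qed.

(** The bound is affine in [g k], which averages to [g k.+1] over one step. Only a jump of the
    maximum from [s] to [g k.+1 z] costs anything, and [subr_mul_ln_le] pays for it. *)
Let split_mass_le k z (s : R) : 0 < s <= 1 ->
  \sum_y split_mass k z y s <= s - g k z * ln s.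
Proof.
have gi t w : 0 <= g t w <= 1 by exact: sum_step_prob_itv.
elim: k z s => [|k IH] z s /andP[s0 s1].
  have /andP[u0 u1] := gi 0%N z.
  rewrite (bigD1 z) //= big1 ?addr0 => [|y /negPf yz].
    rewrite /split_mass leqn0; case: eqP => [->|_].
      rewrite sum_step_prob0 /= eqxx mulr1.
      apply: (le_trans _ (subr_mul_ln_le s0 u0)).
      by rewrite lerDl oppr_ge0 mulr_ge0_le0 // ln_le0.
    by rewrite /= eqxx mulr1 lerDl oppr_ge0 mulr_ge0_le0 // ln_le0.
  rewrite /split_mass leqn0; case: eqP => [->|_].
    by rewrite sum_step_prob0 /= eq_sym yz mulr0.
  by rewrite /= eq_sym yz mulr0.
have /andP[u0 u1] := gi k.+1 z.
set m := Num.max s (g k.+1 z).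
have m01 : 0 < m <= 1 by rewrite lt_max s0 ge_max s1 u1.
apply: (@le_trans _ _ (m - g k.+1 z * ln m)); last first.
  rewrite /m; case: (leP (g k.+1 z) s) => // _.
  exact: subr_mul_ln_le.
apply: (le_trans (ler_sum _ (fun y _ => split_massS k z y s))).
rewrite exchange_big /=; under eq_bigr do rewrite -mulr_sumr.
apply: (@le_trans _ _ (\sum_z' p z z' * (m - g k z' * ln m))).
  by apply: ler_sum => z' _; rewrite ler_wpM2l ?hp.1 // IH.
under eq_bigr do rewrite mulrBr mulrA.
by rewrite sumrB -!mulr_suml hp.2 mul1r {2}/g sum_step_probS.
Qed.

Lemma sum_even_step_le pi a : distribution_on pi -> reversible p pi ->
    0 < a <= 1 ->
  \sum_y pi y * (\sum_w step_prob p (n y + n y)%N y w * f w)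
  <= a - (\sum_y pi y * f y) * ln a.
Proof.
move=> hpi hrev ha.
(* Start from [pi] with [N] steps left, so that no recording moment has passed yet. *)
pose N := (\max_y n y)%N.
have nN y : (n y <= N)%N by exact: leq_bigmax.
apply: (@le_trans _ _ (\sum_z pi z * (a - g N z * ln a))); last first.
  under eq_bigr do rewrite mulrBr mulrA.
  rewrite sumrB -!mulr_suml hpi.2 mul1r lerD2l lerN2 le_eqVlt; apply/orP; left.
  apply/eqP; congr (_ * _); rewrite /g.
  under [RHS]eq_bigr do rewrite mulr_sumr.
  rewrite [RHS]exchange_big /=; apply: eq_bigr => y _.
  rewrite -(step_prob_stationary N y hrev) mulr_suml.
  by apply: eq_bigr => z _; rewrite mulrA.
apply: le_trans (ler_sum _ (fun z _ =>
  ler_wpM2l (hpi.1 z) (split_mass_le N z ha))).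
under [leRHS]eq_bigr do rewrite mulr_sumr.
(* Equality holds for each [y]: stationarity gives law [pi] with [n y] steps left, and reversibility
   turns the remaining path to [y] into one from [y]. *)
rewrite exchange_big /=; apply: ler_sum => y _.
rewrite /split_mass nN.
under [leRHS]eq_bigr do rewrite mulr_sumr.
rewrite exchange_big /=.
rewrite mulr_sumr le_eqVlt; apply/orP; left; apply/eqP.
under [LHS]eq_bigr do rewrite step_probD mulr_suml mulr_sumr.
rewrite exchange_big /=; apply: eq_bigr => w _.
under [RHS]eq_bigr do rewrite !mulrA.
rewrite -!mulr_suml (step_prob_stationary _ _ hrev) -[RHS]mulrA [RHS]mulrCA.
rewrite (step_prob_reversible _ _ _ hrev) [RHS]mulrCA /g mulr_suml mulr_sumr.
apply: eq_bigr => v _.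
by rewrite -[in LHS]mulrA [in LHS](mulrC (step_prob _ _ y w)).
Qed.

End Maximal.

Lemma sum_step_prob_le pi x (t : S -> nat) : distribution_on pi ->
    reversible p pi -> 0 < pi x ->
  \sum_y step_prob p (t y) x y <= 2 * (1 - ln (pi x)).
Proof.
move=> hpi hrev x0.
have x1 : pi x <= 1.
  by rewrite -hpi.2 (bigD1 x) //= lerDl sumr_ge0 // => y _; exact: hpi.1.
have parity b : \sum_y step_prob p (b + (t y)./2.*2)%N x y <= 1 - ln (pi x).
  rewrite -(ler_pM2l x0) mulr_sumr mulrBr mulr1.
  (* [f] is [P^b 1_x], whose [pi]-mean is [pi x] by stationarity; hence the choice [a = pi x]. *)
  pose f y := step_prob p b y x.
  have hf y : 0 <= f y <= 1 by rewrite step_prob_ge0 step_prob_le1.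
  have := @sum_even_step_le f (fun y => (t y)./2) hf pi (pi x) hpi hrev.
  rewrite x0 x1 (step_prob_stationary _ _ hrev) => /(_ isT).
  apply: le_trans; apply: ler_sum => y _.
  by rewrite (step_prob_reversible _ _ _ hrev) addnC step_probD addnn.
apply: (@le_trans _ _ (\sum_y (step_prob p (0 + (t y)./2.*2)%N x y
                              + step_prob p (1 + (t y)./2.*2)%N x y))).
  apply: ler_sum => y _; rewrite -{1}[t y]odd_double_half.
  by case: (odd _); rewrite ?lerDl ?lerDr step_prob_ge0.
by rewrite big_split /= mulrDl !mul1r; apply: lerD;
  [exact: (parity false)|exact: (parity true)].
Qed.

End Chain.

(* The right-hand side lives in \bar R, where (0%:E)^-1 = +oo and lne +oo = +oo:
   it is +oo when pi x = 0. *)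
Theorem proposition1p5 (R : realType) (S : finType) (p : S -> S -> R)
    (pi : S -> R) (hp : transition_matrix p) (hpi : distribution_on pi)
    (hrev : reversible p pi) (x : S) :
  ((\sum_(y : S) pstar p x y)%:E
     <= (2 * expR 1)%:E * maxe 1%:E (lne ((pi x)%:E^-1)))%E.
Proof.
have e2 : (2 : R) <= expR 1 by rewrite -[leLHS]/(1 + 1) expR_ge1Dx.
have e0 : 0 < 2 * expR 1 :> R by rewrite mulr_gt0 ?expR_gt0.
have := hpi.1 x; rewrite le_eqVlt => /orP[/eqP <-|x0].
  by rewrite inve0 /= maxey gt0_muley ?lte_fin // leey.
have bound : \sum_y pstar p x y <= 2 * (1 - ln (pi x)).
  apply: (@ler_sup_approx _ _ (fun y t => step_prob p t x y)) => [y|t]; last first.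
    exact: (@sum_step_prob_le _ _ _ hp pi).
  by exists 1 => _ [t _ <-]; exact: step_prob_le1.
rewrite inver (gt_eqF x0) lne_EFin ?invr_gt0 // lnV ?posrE //.
rewrite -EFin_max -EFinM lee_fin (le_trans bound) // -mulrA ler_pM2l //.
set m := Num.max _ _.
have m1 : 1 <= m by rewrite le_max lexx.
have ml : - ln (pi x) <= m by rewrite le_max lexx orbT.
(* Both [1] and [- ln (pi x)] are at most [m]; the resulting factor [2] is absorbed by [expR 1]. *)
apply: (@le_trans _ _ (2 * m)); first by lra.
by rewrite ler_wpM2r // (le_trans _ m1).
Qed.
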